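(* For every finite-dimensional Banach ring $R$ and every compact Hausdorff space $K$, the Banach ring $C(K,R)$ is Hirsch.
   Context: Banach spaces are over the field of real or complex numbers. A topological ring is an Abelian topological group $R$ (written additively, identity $0$) endowed with a continuous associative binary operation which is distributive over addition on both sides (no unit and no commutativity of multiplication is assumed). A Banach ring is a Banach space $X$ endowed with a binary operation $\cdot:X\times X\to X$ turning $X$ into a topological ring. For a Banach ring $R$ with norm $\|\cdot\|$ and a compact Hausdorff space $K$, $C(K,R)$ is the Banach ring of continuous functions $f:K\to R$ with pointwise operations and norm $\|f\|_K=\sup_{x\in K}\|f(x)\|$. A series $\sum_{n\in\omega}x_n$ in an Abelian topological group $G$ unconditionally converges to $x\in G$ if for any neighborhood $U$ of $0$ there is a finite set $F\subset\omega$ such that $\sum_{i\in J}x_i\in x+U$ for any finite set $J\subset\omega$ containing $F$; it is unconditionally convergent if it unconditionally converges to some $x\in G$. A topological ring $R$ is Hirsch if for any unconditionally convergent series $\sum_{n\in\omega}x_n$ in $R$ and any neighborhood $U\subseteq R$ of $0$ there exists a neighborhood $V\subseteq R$ of $0$ such that $\sum_{n\in F}a_nx_n\in U$ for any finite set $F\subset\omega$ and any sequence $(a_n)_{n\in F}\in V^F$. *)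

(* Defs.v *)
From HB Require Import structures.
From mathcomp Require Import all_boot all_order all_algebra finmap.
From mathcomp Require Import boolp classical_sets reals topology normedtype.
From mathcomp Require Import tvs complex.

Set Implicit Arguments.
Unset Strict Implicit.
Unset Printing Implicit Defensive.

Import Order.TTheory GRing.Theory Num.Theory.
Import numFieldNormedType.Exports.

Local Open Scope classical_set_scope.
Local Open Scope ring_scope.

(* Topological rings without unit and without commutativity: MathComp's ring
   structures are all unital, hence a separate multiplication. *)
HB.mixin Record TopologicalZmodule_isTopologicalRng A & TopologicalZmodule A := {
  rmul : A -> A -> A;
  rmulA : associative rmul;
  rmulDl : left_distributive rmul +%R;
  rmulDr : right_distributive rmul +%R;
  rmul_continuous : continuous (fun z : A * A => rmul z.1 z.2)
}.

#[short(type="topologicalRngType")]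
HB.structure Definition TopologicalRng :=
  {A of TopologicalZmodule A & TopologicalZmodule_isTopologicalRng A}.

(* The multiplication is only required to be biadditive and continuous:
   neither F-bilinearity nor submultiplicativity of the norm is assumed. *)
#[short(type="banachRingType")]
HB.structure Definition BanachRing (F : numFieldType) :=
  {A of CompleteNormedModule F A & TopologicalZmodule_isTopologicalRng A}.

Definition finite_dimensional (F : numFieldType) (V : lmodType F) : Prop :=
  exists n : nat, inhabited (Vector.axiom n V).

Definition unconditionally_converges_to (G : topologicalZmodType)
    (x : nat -> G) (l : G) : Prop :=
  forall U : set G, nbhs 0 U ->
    exists I : {fset nat}, forall J : {fset nat}, (I `<=` J)%fset ->
      exists2 u, U u & \sum_(i <- J) x i = l + u.

Definition unconditionally_convergent (G : topologicalZmodType)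
    (x : nat -> G) : Prop :=
  exists l : G, unconditionally_converges_to x l.

Definition hirsch (A : topologicalRngType) : Prop :=
  forall x : nat -> A, unconditionally_convergent x ->
  forall U : set A, nbhs 0 U ->
  exists2 V : set A, nbhs 0 V &
    forall (I : {fset nat}) (a : nat -> A),
      (forall n, n \in I -> V (a n)) -> U (\sum_(n <- I) rmul (a n) (x n)).

(* The compactness proof is a parameter of the type, because the supremum norm
   is a norm only on a compact space; the alias also hides the topology that
   continuousType inherits from the function space. *)
Definition cfun (K : topologicalType) (cK : compact [set: K])
  (V : topologicalType) : Type := continuousType K V.

Section cfun_base.
Context (K : topologicalType) (cK : compact [set: K]) (V : topologicalType).
Local Notation C := (cfun cK V).

HB.instance Definition _ := Choice.copy C (continuousType K V).

Definition cfun_fun (f : C) : K -> V := f : continuousType K V.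
Coercion cfun_fun : cfun >-> Funclass.

Definition mkcfun (f : K -> V) (cf : continuous f) : C :=
  mkcts cf : continuousType K V.

Lemma cfunP (f g : C) : (forall x, f x = g x) -> f = g.
Proof. by move=> fg; apply/continuousEP. Qed.

Lemma cfun_continuous (f : C) : continuous f.
Proof. exact: cts_fun. Qed.

End cfun_base.

Section cfun_lmod.
Context (F : numFieldType) (K : topologicalType) (cK : compact [set: K]).
Context (V : normedModType F).
Local Notation C := (cfun cK V).

Lemma cfun_cst_subproof (v : V) : continuous (fun _ : K => v).
Proof. by move=> x; exact: cvg_cst. Qed.

Lemma cfun_add_subproof (f g : C) : continuous (fun x => f x + g x).
Proof. by move=> x; apply: cvgD; exact: cfun_continuous. Qed.

Lemma cfun_opp_subproof (f : C) : continuous (fun x => - f x).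
Proof. by move=> x; apply: cvgN; exact: cfun_continuous. Qed.

Lemma cfun_scale_subproof (a : F) (f : C) : continuous (fun x => a *: f x).
Proof. by move=> x; apply: cvgZr; exact: cfun_continuous. Qed.

Definition cfun_zero : C := mkcfun cK (@cfun_cst_subproof 0).
Definition cfun_add (f g : C) : C := mkcfun cK (@cfun_add_subproof f g).
Definition cfun_opp (f : C) : C := mkcfun cK (@cfun_opp_subproof f).
Definition cfun_scale (a : F) (f : C) : C :=
  mkcfun cK (@cfun_scale_subproof a f).

Let addA : associative cfun_add.
Proof. by move=> f g h; apply: cfunP => x; exact: addrA. Qed.
Let addC : commutative cfun_add.
Proof. by move=> f g; apply: cfunP => x; exact: addrC. Qed.
Let add0 : left_id cfun_zero cfun_add.
Proof. by move=> f; apply: cfunP => x; exact: add0r. Qed.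
Let addN : left_inverse cfun_zero cfun_opp cfun_add.
Proof. by move=> f; apply: cfunP => x; exact: addNr. Qed.

HB.instance Definition _ := GRing.isZmodule.Build C addA addC add0 addN.

Let scaleA (a b : F) (f : C) :
  cfun_scale a (cfun_scale b f) = cfun_scale (a * b) f.
Proof. by apply: cfunP => x; exact: scalerA. Qed.
Let scale1 : left_id 1 cfun_scale.
Proof. by move=> f; apply: cfunP => x; exact: scale1r. Qed.
Let scaleDr : right_distributive cfun_scale +%R.
Proof. by move=> a f g; apply: cfunP => x; exact: scalerDr. Qed.
Let scaleDl (f : C) : {morph cfun_scale^~ f : a b / a + b >-> a + b}.
Proof. by move=> a b; apply: cfunP => x; exact: scalerDl. Qed.

HB.instance Definition _ :=
  GRing.Zmodule_isLmodule.Build F C scaleA scale1 scaleDr scaleDl.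

Lemma cfunD (f g : C) x : cfun_fun (f + g) x = f x + g x. Proof. by []. Qed.
Lemma cfunN (f : C) x : cfun_fun (- f) x = - f x. Proof. by []. Qed.
Lemma cfunB (f g : C) x : cfun_fun (f - g) x = f x - g x. Proof. by []. Qed.
Lemma cfun0 x : cfun_fun (0 : C) x = 0. Proof. by []. Qed.
Lemma cfunZ a (f : C) x : cfun_fun (a *: f) x = a *: f x. Proof. by []. Qed.

(* Norms take their values in F, e.g. in R[i]; the supremum is the least upper
   bound for the (partial) order of F, and 0 if K is empty. *)
Definition cfun_norm (f : C) : F := supremum 0 (range (fun x => `|f x|)).

Lemma cfun_max (f : C) : [set: K] !=set0 ->
  exists c, forall x, `|f x| <= `|f c|.
Proof.
case=> x0 _; apply: contrapT => /forallNP nmax.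
have lt_ex c : exists t, `|f c| < `|f t|.
  have /existsNP[t nt] := nmax c; exists t.
  by rewrite real_ltNge ?normr_real//; apply/negP.
pose B c := [set t | `|f c| <= `|f t|].
pose G := filter_from [set: K] B.
have FG : Filter G.
  apply: filter_from_filter; first by exists x0.
  move=> s t _ _.
  have [st|ts] := real_leP (normr_real (f s)) (normr_real (f t)).
    by exists t => // u tu; split=> //; exact: (le_trans st tu).
  by exists s => // u su; split=> //; exact: (le_trans (ltW ts) su).
have /compact_near_coveringP/(_ _ G (fun t x => `|f x| < `|f t|) FG) := cK.
case=> [x _|t _ tP]; last by have /= := tP t (lexx `|f t|) t I; rewrite ltxx.
have [t xt] := lt_ex x.
exists ([set y | `|f y| < `|f t|], B t).
  split=> /=; last by exists t.
  have /cvgrPdist_lt/(_ (`|f t| - `|f x|)) := @cfun_continuous _ cK _ f x.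
  rewrite subr_gt0 => /(_ xt); apply: filterS => y fxy /=.
  have -> : f y = f x - (f x - f y) by rewrite opprB addrC subrK.
  by rewrite (le_lt_trans (ler_normB _ _))// -ltrBrDl.
by move=> [y u] /= [yt tu]; exact: lt_le_trans yt tu.
Qed.

Lemma cfun_normE (f : C) c : (forall x, `|f x| <= `|f c|) ->
  cfun_norm f = `|f c|.
Proof.
move=> fc; rewrite /cfun_norm /supremum ifF; last first.
  by apply/negbTE/set0P; exists `|f c|; exists c.
have sc : supremums (range (fun x => `|f x|)) `|f c|.
  by split=> [_ [x _ <-]|y]; [exact: fc|apply; exists c].
case: xgetP => [y _ sy|/(_ `|f c|)//].
exact: is_subset1_supremums sy sc.
Qed.

Variant cfun_norm_spec (f : C) : F -> Prop :=
| CfunNormEmpty of (K -> False) : cfun_norm_spec f 0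
| CfunNormMax c of (forall x, `|f x| <= `|f c|) : cfun_norm_spec f `|f c|.

Lemma cfun_normP (f : C) : cfun_norm_spec f (cfun_norm f).
Proof.
have [/eqP K0|/set0P/(cfun_max f)[c fc]] := boolP ([set: K] == set0).
  rewrite /cfun_norm K0 image_set0 supremum0; constructor => x.
  by have : [set: K] x by []; rewrite K0.
by rewrite (cfun_normE fc); constructor.
Qed.

Lemma le_cfun_norm (f : C) x : `|f x| <= cfun_norm f.
Proof. by case: cfun_normP => [/(_ x)|c]. Qed.

Lemma cfun_norm_le (f : C) e : 0 <= e -> (forall x, `|f x| <= e) ->
  cfun_norm f <= e.
Proof. by case: cfun_normP. Qed.

Lemma cfun_norm_lt (f : C) e : 0 < e -> (forall x, `|f x| < e) ->
  cfun_norm f < e.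
Proof. by case: cfun_normP. Qed.

Lemma cfun_norm_ge0 (f : C) : 0 <= cfun_norm f.
Proof. by case: cfun_normP. Qed.

Let ler_cfun_normD (f g : C) :
  cfun_norm (f + g) <= cfun_norm f + cfun_norm g.
Proof.
apply: cfun_norm_le => [|x]; first by rewrite addr_ge0// cfun_norm_ge0.
by rewrite cfunD (le_trans (ler_normD _ _))// lerD// le_cfun_norm.
Qed.

Let cfun_normZ a (f : C) : cfun_norm (a *: f) = `|a| * cfun_norm f.
Proof.
case: (cfun_normP f) => [K0|c fc].
  by rewrite mulr0; case: cfun_normP => // c; have := K0 c.
rewrite (@cfun_normE _ c) => [|x]; rewrite !cfunZ !normrZ//.
by rewrite ler_wpM2l.
Qed.

Let cfun_norm0_eq0 (f : C) : cfun_norm f = 0 -> f = 0.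
Proof.
move=> f0; apply: cfunP => x; rewrite cfun0; apply/normr0_eq0/le_anti.
by rewrite normr_ge0 -f0 le_cfun_norm.
Qed.

HB.instance Definition _ :=
  Lmodule_isNormed.Build F C ler_cfun_normD cfun_normZ cfun_norm0_eq0.

Lemma cfun_normrE (f : C) : `|f| = cfun_norm f. Proof. by []. Qed.

Lemma cfun_ballE (f g : C) (e : F) : ball f e g = (cfun_norm (f - g) < e) :> Prop.
Proof. by rewrite -ball_normE. Qed.

Lemma cfun_ball (f g : C) (e : F) x : ball f e g -> `|f x - g x| < e.
Proof. by rewrite cfun_ballE => /(le_lt_trans (le_cfun_norm _ x)). Qed.

End cfun_lmod.

Section cfun_complete.
Context (F : numFieldType) (K : topologicalType) (cK : compact [set: K]).
Context (V : completeNormedModType F).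
Local Notation C := (cfun cK V).

Let cfun_cauchy_cvg (G : set_system C) :
  ProperFilter G -> cauchy G -> cvg G.
Proof.
move=> PG /cauchyP cG.
have cGx x : cvg ((fun f : C => f x) @ G).
  apply: cauchy_cvg; apply/cauchyP => e e0.
  have [f Gf] := cG _ e0; exists (f x).
  suff : G (fun g : C => ball (f x) e (g x)) by [].
  by apply: filterS Gf => g /(cfun_ball x); rewrite -ball_normE.
pose l x := lim ((fun f : C => f x) @ G).
have unif e : 0 < e -> exists2 f : C, G (ball f e) & forall x, `|f x - l x| < e.
  move=> e0; have e20 : 0 < e / 2 by rewrite divr_gt0.
  have [f Gf] := cG _ e20; exists f.
    apply: filterS Gf => g; apply: le_ball.
    by rewrite ler_pdivrMr// ler_peMr ?ltW// ltr1n.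
  move=> x; have := cGx x => /cvgrPdist_lt /(_ _ e20) Gx.
  have [g []] := filter_ex (filterI Gf Gx).
  move=> /(cfun_ball x) fg gl.
  have -> : f x - l x = (f x - g x) + (g x - l x) by rewrite addrA subrK.
  rewrite (splitr e).
  rewrite (le_lt_trans (ler_normD _ _))// ltrD//.
  by rewrite distrC.
have cl : continuous l.
  move=> x; apply/cvgrPdist_lt => e e0; have e30 : 0 < e / 3 by rewrite divr_gt0.
  have [f _ fl] := unif _ e30.
  have /cvgrPdist_lt/(_ _ e30) := @cfun_continuous _ cK _ f x.
  apply: filterS => y fxy.
  have -> : l x - l y = (l x - f x) + (f x - f y) + (f y - l y).
    by rewrite !addrA !subrK.
  have -> : e = e / 3 + e / 3 + e / 3.
    by rewrite -!mulrDl -mulr2n -mulrSr -[e *+ 3]mulr_natr mulfK ?pnatr_eq0.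
  rewrite (le_lt_trans (ler_normD _ _))// ltrD// (le_lt_trans (ler_normD _ _))//.
  by rewrite ltrD// distrC.
apply/cvg_ex; exists (mkcfun cK cl); apply/cvgrPdist_lt => e e0.
have e20 : 0 < e / 2 by rewrite divr_gt0.
have [f Gf fl] := unif _ e20.
apply: filterS Gf => g fg; rewrite cfun_normrE; apply: cfun_norm_lt => // x; rewrite cfunB/=.
have -> : l x - g x = (l x - f x) + (f x - g x) by rewrite addrA subrK.
rewrite (splitr e).
rewrite (le_lt_trans (ler_normD _ _))// ltrD//.
  by rewrite distrC.
exact: (cfun_ball x fg).
Qed.

HB.instance Definition _ := Uniform_isComplete.Build C cfun_cauchy_cvg.
End cfun_complete.

Section cfun_ring.
Context (F : numFieldType) (K : topologicalType) (cK : compact [set: K]).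
Context (A : banachRingType F).
Local Notation C := (cfun cK A).

Lemma cfun_mul_subproof (f g : C) : continuous (fun x => rmul (f x) (g x)).
Proof.
move=> x; apply: (@continuous_comp _ _ _ (fun x => (f x, g x))
   (fun z : A * A => rmul z.1 z.2)); last exact: rmul_continuous.
by apply: cvg_pair; exact: cfun_continuous.
Qed.

Definition cfun_mul (f g : C) : C := mkcfun cK (@cfun_mul_subproof f g).

Let mulA : associative cfun_mul.
Proof. by move=> f g h; apply: cfunP => x; exact: rmulA. Qed.
Let mulDl : left_distributive cfun_mul +%R.
Proof. by move=> f g h; apply: cfunP => x; exact: rmulDl. Qed.
Let mulDr : right_distributive cfun_mul +%R.
Proof. by move=> f g h; apply: cfunP => x; exact: rmulDr. Qed.

Let mul_continuous : continuous (fun z : C * C => cfun_mul z.1 z.2).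
Proof.
move=> [f g]; apply/cvgrPdist_lt => e e0 /=.
have : \forall z \near nbhs ((0, 0) : A * A), [set: K] `<=`
    (fun x => `|rmul (f x) (g x) - rmul (f x + z.1) (g x + z.2)| < e).
  have /compact_near_coveringP cov := cK.
  apply: (cov _ (nbhs ((0, 0) : A * A))
    (fun z x => `|rmul (f x) (g x) - rmul (f x + z.1) (g x + z.2)| < e)).
  move=> x _.
  pose h (p : K * (A * A)) := rmul (f p.1) (g p.1)
    - rmul (f p.1 + p.2.1) (g p.1 + p.2.2).
  suff : h p @[p --> (x, ((0, 0) : A * A))] --> h (x, (0, 0)).
    rewrite [h (x, _)]/h/= !addr0 subrr.
    by move/cvgr0_norm_lt => /(_ _ e0).
  have cf1 (k : C) : k p.1 @[p --> (x, ((0, 0) : A * A))] --> k x.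
    by apply: cvg_comp; [exact: cvg_fst|exact: cfun_continuous].
  have cz1 : p.2.1 @[p --> (x, ((0, 0) : A * A))] --> (0 : A).
    by apply: (@cvg_comp _ _ _ snd fst _ (nbhs ((0, 0) : A * A)));
      [exact: cvg_snd|exact: cvg_fst].
  have cz2 : p.2.2 @[p --> (x, ((0, 0) : A * A))] --> (0 : A).
    by apply: (@cvg_comp _ _ _ snd snd _ (nbhs ((0, 0) : A * A)));
      [exact: cvg_snd|exact: cvg_snd].
  have cm (u v : K * (A * A) -> A) (a b : A) :
      u p @[p --> (x, ((0, 0) : A * A))] --> a ->
      v p @[p --> (x, ((0, 0) : A * A))] --> b ->
      rmul (u p) (v p) @[p --> (x, ((0, 0) : A * A))] --> rmul a b.
    move=> ua vb; apply: (@cvg_comp _ _ _ (fun p => (u p, v p))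
      (fun z : A * A => rmul z.1 z.2) _ (nbhs (a, b))).
      exact: cvg_pair.
    exact: (@rmul_continuous A (a, b)).
  exact: (cvgB (cm _ _ _ _ (cf1 f) (cf1 g))
    (cm _ _ _ _ (cvgD (cf1 f) cz1) (cvgD (cf1 g) cz2))).
move=> /nbhs_ballP[d /= d0 dP].
exists (ball f d, ball g d); first by split; exact: nbhsx_ballx.
move=> [f' g'] [/= ff gg].
rewrite cfun_normrE; apply: cfun_norm_lt => // x.
have ball0 (k k' : C) : ball k d k' -> ball (0 : A) d (k' x - k x).
  by move=> /(cfun_ball x); rewrite -ball_normE/= sub0r normrN distrC.
have := dP (f' x - f x, g' x - g x) (conj (ball0 _ _ ff) (ball0 _ _ gg)) x I.
by rewrite /= !subrKC.
Qed.

HB.instance Definition _ := TopologicalZmodule_isTopologicalRng.Build C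
  mulA mulDl mulDr mul_continuous.

End cfun_ring.

(* Main.v *)
(* The finite partial sums of an unconditionally convergent series x_n in
   C(K, R) are bounded in norm by some M, hence so are those of x_n(t) for every
   t in K. As R is finite-dimensional over the reals, separating the signs of
   the real coordinates of the x_n(t) yields a constant D, independent of t,
   with sum_(n in F) |x_n(t)| <= D M. Since the multiplication is continuous and
   biadditive, |a b| <= e |b| for all b as soon as |a| is small enough, whence
   |sum_(n in F) a_n(t) x_n(t)| <= e D M. *)
Require Import Defs.
From mathcomp Require Import all_boot all_order all_algebra finmap.
From mathcomp Require Import boolp classical_sets reals topology normedtype.
From mathcomp Require Import derive complex.
Import Order.TTheory GRing.Theory Num.Theory.
Import numFieldNormedType.Exports.
Local Open Scope classical_set_scope.
Local Open Scope ring_scope.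

(** * Equivalence of norms on real row vectors *)

Lemma le_coord_mx_norm (R : realType) m (x : 'rV[R]_m) j : `|x 0 j| <= `|x|.
Proof.
rewrite [leRHS]/Num.norm/= mx_normrE.
exact: (le_bigmax _ (fun ij => `|x ij.1 ij.2|) (0, j)).
Qed.

(** [N] is Lipschitz for the max norm, hence continuous, and attains a positive minimum on the
    compact unit sphere. It is a bare function so that it can be a norm pulled back from another
    space. *)
Lemma rV_norm_equiv (R : realType) m (N : 'rV[R]_m -> R) :
  (forall x y, N (x + y) <= N x + N y) ->
  (forall r x, N (r *: x) = `|r| * N x) ->
  (forall x, N x = 0 -> x = 0) ->
  exists b c : R, [/\ 0 <= b, 0 <= c, forall x, N x <= b * `|x| &
    forall x, `|x| <= c * N x].
Proof.
move=> ND NZ N0.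
have N00 : N 0 = 0 by rewrite -(scale0r 0) NZ normr0 mul0r.
have NN x : N (- x) = N x by rewrite -scaleN1r NZ normrN1 mul1r.
have Nge0 x : 0 <= N x.
  by have := ND x (- x); rewrite subrr N00 NN -mulr2n pmulrn_lge0.
have Nsum (s : seq 'I_m) (F : 'I_m -> 'rV[R]_m) :
    N (\sum_(j <- s) F j) <= \sum_(j <- s) N (F j).
  elim: s => [|j s IH]; first by rewrite !big_nil N00.
  by rewrite !big_cons (le_trans (ND _ _))// lerD2l.
pose b := \sum_(j < m) N 'e_j.
have b0 : 0 <= b by apply: sumr_ge0.
have Nb x : N x <= b * `|x|.
  rewrite {1}[x]row_sum_delta (le_trans (Nsum _ _))//.
  rewrite mulr_suml ler_sum// => j _.
  by rewrite NZ mulrC ler_wpM2l// le_coord_mx_norm.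
have NB x y : `|N x - N y| <= b * `|x - y|.
  rewrite (le_trans _ (Nb _))// ler_norml lerBrDr lerBlDr.
  have := ND (x - y) y; have := ND (y - x) x.
  rewrite !subrK -[N (y - x)]NN opprB => h1 -> /=; rewrite andbT.
  by rewrite addrC lerBlDl.
have cN : continuous N.
  move=> x; apply/(@cvgrPdist_lt _ R _ (nbhs x)) => e e0.
  have d0 : 0 < e / (b + 1) by rewrite divr_gt0// ltr_wpDl.
  have /nbhs_ballP : exists2 d : R, 0 < d &
      ball x d `<=` [set y | `|N x - N y| < e].
    exists (e / (b + 1)) => // y; rewrite -ball_normE/= => xy.
    rewrite (le_lt_trans (NB _ _))//.
    apply: (@le_lt_trans _ _ ((b + 1) * `|x - y|)).
      by rewrite ler_wpM2r// lerDl.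
    by rewrite mulrC -ltr_pdivlMr ?ltr_wpDl.
  by [].
pose S := [set x : 'rV[R]_m | `|x| = 1].
have cS : compact S.
  apply: bounded_closed_compact.
    exists 1; split; first exact: real1.
    by move=> M M1 x /= ->; exact: ltW.
  rewrite [S](_ : _ = Num.norm @^-1` [set 1])//.
  by apply: preimage_closed => [x _|]; [exact: norm_continuous|exact: closed_eq].
have normS x : x != 0 -> S (`|x|^-1 *: x).
  by move=> x0; rewrite /S/= normrZ normfV normr_id mulVf// normr_eq0.
(* An empty sphere means that 0 is the only vector, so [c = 0] will do. *)
have [/eqP S0|/set0P S0] := boolP (S == set0).
  exists b, 0; split=> // x; have [->|/normS] := eqVneq x 0; last by rewrite S0.
  by rewrite normr0 mul0r.
have [x0] := EVT_min_rV S0 cS (continuous_subspaceT cN).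
rewrite inE => Sx0 minx0.
have Nx0 : 0 < N x0.
  rewrite lt_neqAle Nge0 andbT eq_sym; apply/eqP => /N0 x00.
  by move: Sx0; rewrite /S/= x00 normr0 => /esym/eqP; rewrite oner_eq0.
exists b, (N x0)^-1; split=> // [|x]; first by rewrite invr_ge0.
have [->|xn0] := eqVneq x 0; first by rewrite normr0 N00 mulr0.
rewrite -ler_pdivrMl ?invr_gt0// invrK.
have := minx0 (`|x|^-1 *: x); rewrite inE => /(_ (normS _ xn0)).
by rewrite NZ normfV normr_id ler_pdivlMl ?normr_gt0// mulrC.
Qed.

(** * Absolute summability in finite dimension *)

(** [D] is fixed before the family and its bound [M], so that one constant serves all points of a
    compact space at once. *)
Definition absolutely_summing {F : numFieldType} (V : normedModType F) :=
  exists2 D : F, 0 <= D &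
    forall (I : seq nat) (v : nat -> V) (M : F),
      (forall P : pred nat, `|\sum_(i <- I | P i) v i| <= M) ->
      \sum_(i <- I) `|v i| <= D * M.

(** This treats real and complex scalars together: [i] embeds the reals, and [T] makes [V] a copy of
    a real coordinate space. Norms in [V] are images of reals, so they pull back along [T] to a real
    norm [N]. *)
Lemma absolutely_summing_coord (R : realType) (F : numFieldType)
    (V : normedModType F) (i : {rmorphism R -> F}) (m : nat)
    (T : 'rV[R]_m -> V) (S : V -> 'rV[R]_m) :
  {mono i : x y / x <= y} -> (forall z : F, 0 <= z -> exists r, z = i r) ->
  (forall x y, T (x + y) = T x + T y) ->
  (forall r x, T (r *: x) = i r *: T x) ->
  injective T -> cancel S T ->
  absolutely_summing V.
Proof.
move=> ile ireal TD TZ Tinj ST.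
have /choice[N NE] : forall x, exists r : R, `|T x| = i r.
  by move=> x; exact: ireal.
have i0 r : (0 <= i r) = (0 <= r) by rewrite -(rmorph0 i) ile.
have inorm r : `|i r| = i `|r|.
  have [r0|r0] := ger0P r; first by rewrite ger0_norm// i0.
  by rewrite ler0_norm ?rmorphN// -oppr_ge0 -rmorphN i0 oppr_ge0 ltW.
have iinj : injective i by exact: fmorph_inj.
have ND x y : N (x + y) <= N x + N y.
  by rewrite -ile rmorphD -!NE TD ler_normD.
have NZ r x : N (r *: x) = `|r| * N x.
  by apply: iinj; rewrite rmorphM -!NE TZ normrZ inorm.
have T0 : T 0 = 0 by rewrite -(scale0r 0) TZ rmorph0 scale0r.
have N0 x : N x = 0 -> x = 0.
  move=> Nx; apply/Tinj/eqP.
  by rewrite T0 -normr_eq0 NE Nx rmorph0.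
have [b [c [b0 c0 Nb cN]]] := rV_norm_equiv _ _ _ ND NZ N0.
have TK : cancel T S by move=> x; apply: Tinj; rewrite ST.
have SD u v : S (u + v) = S u + S v by apply: Tinj; rewrite TD !ST.
have S0 : S 0 = 0 by rewrite -T0 TK.
have Ssum (I : seq nat) P (v : nat -> V) :
    S (\sum_(k <- I | P k) v k) = \sum_(k <- I | P k) S (v k).
  by apply: big_morph.
(* [c] bounds coordinates by [N], 2 counts the signs, [m] the coordinates, and [b] leads back to
   [N]. *)
exists (i (b * (m%:R * (2 * c)))) => [|I v M vM].
  by rewrite i0 !mulr_ge0.
have M0 : 0 <= M by rewrite (le_trans _ (vM xpredT)).
have [M' ME] := ireal _ M0.
have coordM P j : `|\sum_(k <- I | P k) S (v k) 0 j| <= c * M'.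
  have -> : \sum_(k <- I | P k) S (v k) 0 j = (\sum_(k <- I | P k) S (v k)) 0 j.
    by rewrite summxE.
  rewrite (le_trans (le_coord_mx_norm _ _ _ _))// -Ssum (le_trans (cN _))//.
  by rewrite ler_wpM2l// -ile -NE ST -ME.
have sumj j : \sum_(k <- I) `|S (v k) 0 j| <= 2 * c * M'.
  (* On the indices of one sign, the sum of absolute values is, up to sign, a subset sum, bounded by
     [coordM]. *)
  rewrite (bigID (fun k => 0 <= S (v k) 0 j))/= -mulrA mulr_natl mulr2n lerD//.
    rewrite (eq_bigr (fun k => S (v k) 0 j)) => [|k]; last exact: ger0_norm.
    by rewrite (le_trans (ler_norm _)).
  rewrite (eq_bigr (fun k => - S (v k) 0 j)) => [|k].
    by rewrite sumrN (le_trans (ler_norm _))// normrN.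
  by rewrite -ltNge => /ltW; exact: ler0_norm.
have vE k : `|v k| = i (N (S (v k))) by rewrite -NE ST.
rewrite (eq_bigr _ (fun k _ => vE k)) -rmorph_sum ME -rmorphM ile.
rewrite -mulrA (@le_trans _ _ (\sum_(k <- I) b * `|S (v k)|)) ?ler_sum//.
rewrite -mulr_sumr ler_wpM2l//.
apply: (@le_trans _ _ (\sum_(k <- I) \sum_(j < m) `|S (v k) 0 j|)).
  apply: ler_sum => k _; rewrite [leLHS]/Num.norm/= mx_normrE.
  apply/bigmax_leP; split=> [|[z j] _ /=]; first exact: sumr_ge0.
  by rewrite ord1 (bigD1 j)//= lerDl sumr_ge0.
rewrite exchange_big/= -mulrA mulr_natl -[X in _ *+ X](card_ord m).
by rewrite -sumr_const ler_sum.
Qed.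

Lemma finite_dimensional_coord (F : numFieldType) (V : lmodType F) :
  finite_dimensional V ->
  exists n (f : V -> 'rV[F]_n) (g : 'rV[F]_n -> V),
    [/\ cancel f g, cancel g f, forall x y, g (x + y) = g x + g y &
        forall r x, g (r *: x) = r *: g x].
Proof.
case=> n [[f flin [g fg gf]]]; exists n, f, g; split=> // [x y|r x].
  by rewrite -{1}[x]gf -{1}[y]gf -[f (g x)]scale1r -flin fg scale1r.
have f0 : f 0 = 0.
  by rewrite -[in LHS](scaler0 _ (-1)) -[X in f X]addr0 flin scaleN1r addNr.
by rewrite -{1}[x]gf -[_ *: _]addr0 -{1}f0 -flin fg addr0.
Qed.

Lemma absolutely_summing_real (R : realType) (V : normedModType R) :
  finite_dimensional V -> absolutely_summing V.
Proof.
move=> /finite_dimensional_coord[n [f [g [fg gf gD gZ]]]].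
apply: (@absolutely_summing_coord R R V idfun n g f) => //.
- by move=> z _; exists z.
- exact: can_inj gf.
Qed.

Lemma absolutely_summing_complex (R : realType) (V : normedModType R[i]) :
  finite_dimensional V -> absolutely_summing V.
Proof.
move=> /finite_dimensional_coord[n [f [g [fg gf gD gZ]]]].
(* The left half of [x] holds the real parts, the right half the imaginary parts. *)
pose T (x : 'rV[R]_(n + n)) :=
  g (\row_j Complex (lsubmx x 0 j) (rsubmx x 0 j)).
pose S v := row_mx (\row_j complex.Re (f v 0 j)) (\row_j complex.Im (f v 0 j)).
have ST : cancel S T.
  move=> v; rewrite /T /S -[RHS]fg; congr g; apply/rowP => j.
  by rewrite row_mxKl row_mxKr !mxE; case: (f v 0 j).
have TS : cancel T S.
  move=> x; rewrite /T /S gf -[RHS]hsubmxK.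
  by congr row_mx; apply/rowP => j; rewrite !mxE.
apply: (@absolutely_summing_coord R R[i] V (real_complex R) (n + n) T S) => //.
- by move=> x y; exact: lecR.
- by case=> a b; rewrite lecE => /andP[/eqP/= -> _]; exists a.
- by move=> x y; rewrite /T -gD; congr g; apply/rowP => j; rewrite !mxE.
- move=> r x; rewrite /T -gZ; congr g; apply/rowP => j; rewrite !mxE.
  by rewrite /real_complex_def; simpc.
- exact: can_inj TS.
Qed.

(** * Boundedness of finite partial sums *)

(** Sums over sets containing a suitable finite [I] stay within 1 of the limit. The sum over any [J]
    is the one over the union of [I] and [J] minus a subset sum of [I]. *)
Lemma bounded_partial_sums (F : numFieldType) (V : normedModType F)
    (x : nat -> V) :
  unconditionally_convergent x ->
  exists M : F, forall J : {fset nat}, `|\sum_(i <- J) x i| <= M.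
Proof.
case=> l /(_ (ball 0 1) (nbhsx_ballx _ _ ltr01))[I lI].
exists (`|l| + 1 + \sum_(i <- I) `|x i|) => J.
have [u] := lI (I `|` J)%fset (fsubsetUl _ _).
rewrite -ball_normE/= sub0r normrN => u1 sumE.
have sumU : \sum_(i <- (I `|` J)%fset) x i =
    \sum_(i <- J) x i + \sum_(i <- I | i \notin J) x i.
  rewrite (big_fsetID _ (fun i => i \in J) (I `|` J)%fset) /=.
  rewrite [X in _ = _ + X]big_fset_condE.
  congr (_ + _); congr bigop; congr enum_fset; apply/fsetP => i;
    by rewrite !inE/=; case: (i \in J); rewrite ?orbT ?orbF ?andbF.
have -> : \sum_(i <- J) x i = l + u - \sum_(i <- I | i \notin J) x i.
  by rewrite -sumE sumU addrK.
rewrite (le_trans (ler_normB _ _))// lerD//.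
  by rewrite (le_trans (ler_normD _ _))// lerD2l ltW.
rewrite (le_trans (ler_norm_sum _ _ _))// [leRHS](bigID (fun i => i \in J))/=.
by rewrite lerDr sumr_ge0.
Qed.

(** * Small left factors in a biadditive multiplication *)

Lemma ex_floorn (F : numFieldType) (z : F) :
  (exists n : nat, z < n%:R) -> 0 <= z ->
  exists n : nat, n%:R <= z < n.+1%:R.
Proof.
move=> zn z0; case: (ex_minnP zn) => -[|n] zltn minn.
  by have := le_lt_trans z0 zltn; rewrite ltxx.
exists n; rewrite zltn andbT real_leNgt ?ger0_real//.
by apply/negP => /minn; rewrite ltnn.
Qed.

(* The multiplication is only biadditive, so its arguments are rescaled by
   natural numbers instead of scalars. *)
Lemma rmul_small (F : numFieldType) (A : banachRingType F) (e : F) :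
  (forall z : F, 0 <= z -> exists n : nat, z < n%:R) -> 0 < e ->
  exists2 d : F, 0 < d & forall a b : A, `|a| < d -> `|rmul a b| <= e * `|b|.
Proof.
move=> arch e0.
have rmul0 (a : A) : rmul a 0 = 0.
  by apply: (addrI (rmul a 0)); rewrite -rmulDr !addr0.
have rmul0l (a : A) : rmul 0 a = 0.
  by apply: (addrI (rmul 0 a)); rewrite -rmulDl !addr0.
have rmulMnr (a b : A) n : rmul a (b *+ n) = rmul a b *+ n.
  by elim: n => [|n IH]; rewrite ?mulr0n// !mulrS rmulDr IH.
have rmulMnl (a b : A) n : rmul (a *+ n) b = rmul a b *+ n.
  by elim: n => [|n IH]; rewrite ?mulr0n// !mulrS rmulDl IH.
have [d d0 dP] : exists2 d : F, 0 < d &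
    forall a b : A, `|a| < d -> `|b| < d -> `|rmul a b| < 1.
  have /cvgrPdist_lt/(_ 1 ltr01)/nbhs_ballP[d /= d0 dP] :=
    @rmul_continuous A (0, 0).
  exists d => // a b ad bd.
  have := dP (a, b); rewrite /= rmul0 sub0r normrN; apply.
  by split; rewrite -ball_normE/= sub0r normrN.
(* The factor 2 absorbs the rounding of [z] up to [n.+1] below. *)
have [k kP] : exists k : nat, 2 / (d * e) < k%:R.
  by apply: arch; rewrite divr_ge0// mulr_ge0// ltW.
have k0 : 0 < k%:R :> F.
  by rewrite (le_lt_trans _ kP)// divr_ge0// mulr_ge0// ltW.
exists (d / k%:R) => [|a b]; first by rewrite divr_gt0.
rewrite ltr_pdivlMr// => ad.
have [->|b0] := eqVneq b 0; first by rewrite rmul0 !normr0 mulr0.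
have nb0 : 0 < `|b| by rewrite normr_gt0.
(* A large [N] makes [z] at least 1, so that [n.+1 <= 2 * z]; as [z < n.+1], the multiple [c *+ N]
   has norm below [d]. *)
have [N NP] : exists N : nat, d / `|b| < N%:R.
  by apply: arch; rewrite divr_ge0// ltW.
have N0 : 0 < N%:R :> F.
  by rewrite (le_lt_trans _ NP)// divr_ge0// ltW.
pose z := N%:R * `|b| / d.
have z1 : 1 <= z by rewrite /z ler_pdivlMr// mul1r -ler_pdivrMr// ltW.
have z0 : 0 <= z := le_trans ler01 z1.
have [n /andP[nz zn]] := @ex_floorn F z (arch _ z0) z0.
pose c := n.+1%:R^-1 *: b.
have bE : c *+ n.+1 = b.
  by rewrite /c -scaler_nat scalerA divff ?scale1r// pnatr_eq0.
have cN : `|c *+ N| < d.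
  rewrite normrMn normrZ normfV normr_nat -[_ *+ N]mulr_natl mulrCA.
  by rewrite ltr_pdivrMl ?ltr0Sn// -ltr_pdivrMr.
have akd : `|a *+ k| < d by rewrite normrMn -mulr_natr.
have kNc : k%:R * N%:R * `|rmul a c| <= 1.
  have := dP _ _ akd cN; rewrite rmulMnl rmulMnr !normrMn.
  by rewrite -[_ *+ k]mulr_natl -[_ *+ N]mulr_natl mulrA => /ltW.
(* Bounding [n.+1] by [2 * z] and cancelling [N] leaves the factor [2 / (d * k)], which is at most
   [e] by the choice of [k]. *)
have : k%:R * N%:R * `|rmul a b| <= n.+1%:R.
  have -> : `|rmul a b| = n.+1%:R * `|rmul a c|.
    by rewrite -{1}bE rmulMnr normrMn mulr_natl.
  by rewrite mulrCA ler_piMr.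
have : n.+1%:R <= 2 * z by rewrite -natr1 mulr_natl mulr2n lerD.
have -> : 2 * z = N%:R * (2 / d * `|b|).
  by rewrite /z -mulrA mulrCA (mulrC `|b|) !mulrA.
move=> h1 /le_trans/(_ h1); rewrite -mulrA mulrCA ler_pM2l//.
rewrite -ler_pdivlMl// => /le_trans; apply.
rewrite mulrA ler_wpM2r// ler_pdivrMl//.
by move: kP; rewrite invfM mulrA ltr_pdivrMr// => /ltW.
Qed.

(** * The Hirsch property of spaces of continuous functions *)

Lemma hirsch_cfun (F : numFieldType) (A : banachRingType F)
    (K : topologicalType) (cK : compact [set: K]) :
  (forall z : F, 0 <= z -> exists n : nat, z < n%:R) ->
  absolutely_summing A -> hirsch (cfun cK A).
Proof.
move=> arch [D D0 DP] x /bounded_partial_sums[M xM] U /nbhs_ballP[e /= e0 eU].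
have M0 : 0 <= M := le_trans (normr_ge0 _) (xM fset0).
have DM0 : 0 < D * M + 1 by rewrite ltr_wpDl// mulr_ge0.
(* Adding 1 keeps the denominator positive and makes the final estimate strict. *)
have [d d0 dP] := @rmul_small F A (e / (D * M + 1)) arch (divr_gt0 e0 DM0).
exists (ball 0 d); first exact: nbhsx_ballx.
move=> I a aI; apply: eU.
have cfun_sum (J : seq nat) P (f : nat -> cfun cK A) t :
    cfun_fun (\sum_(n <- J | P n) f n) t = \sum_(n <- J | P n) f n t.
  by apply: (big_morph (fun g : cfun cK A => g t)).
rewrite -ball_normE/= sub0r normrN cfun_normrE.
apply: cfun_norm_lt => // t; rewrite cfun_sum.
have ad n : n \in I -> `|a n t| < d.
  by move=> /aI/(@cfun_ball _ _ _ _ _ _ _ t); rewrite cfun0 sub0r normrN.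
rewrite (le_lt_trans (ler_norm_sum _ _ _))//.
apply: (@le_lt_trans _ _ (\sum_(n <- I) e / (D * M + 1) * `|x n t|)).
  by rewrite big_seq [leRHS]big_seq ler_sum// => n nI; exact: dP (ad _ nI).
rewrite -mulr_sumr mulrAC ltr_pdivrMr// ltr_pM2l//.
rewrite (@le_lt_trans _ _ (D * M)) ?ltrDl//.
(* A subset sum of the values at [t] is the value at [t] of a partial sum of [x], so [M] bounds it
   for every [t]. *)
apply: DP => P; rewrite -cfun_sum big_fset_condE.
by apply: le_trans (xM _); exact: le_cfun_norm.
Qed.

Theorem theorem7p1 (R : realType) :
  (forall (A : banachRingType R) (K : topologicalType) (cK : compact [set: K]),
     finite_dimensional A -> hausdorff_space K -> hirsch (cfun cK A)) /\
  (forall (A : banachRingType R[i]) (K : topologicalType)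
     (cK : compact [set: K]),
     finite_dimensional A -> hausdorff_space K -> hirsch (cfun cK A)).
Proof.
have arch (z : R) : 0 <= z -> exists n : nat, z < n%:R.
  by move=> z0; exists (Num.bound z); rewrite archi_boundP.
split=> A K cK fdA _.
  exact/hirsch_cfun/absolutely_summing_real.
apply/hirsch_cfun; last exact: absolutely_summing_complex.
(* A nonnegative complex number is real, which reduces the bound to the Archimedean property of
   [R]. *)
case=> a b; rewrite lecE /= => /andP[/eqP -> /arch[n an]]; exists n.
by rewrite -(rmorph_nat (real_complex R)) ltcR.
Qed.
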